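(* Let $n\ge 2$, let $v_0,\ldots,v_n$ be the vertices of a nondegenerate simplex in $\mathbb{R}^n$, let $g=\frac{1}{n+1}\sum_{i=0}^n v_i$, $u_i=v_i-g$, and $B=\frac{1}{n(n+1)}\sum_{i=0}^{n}u_iu_i^T$. Suppose that the John ellipsoid $E=\{g+x: x^TB^{-1}x\le 1\}$ of the simplex has distinct squared semiaxes $d_1>\cdots>d_n>0$ (the eigenvalues of $B$). Use principal coordinates centered at $g$: let $Q$ be an orthogonal matrix with $Q^TBQ=D=\operatorname{diag}(d_1,\ldots,d_n)$, and let $x=(x_1,\ldots,x_n)\in\mathbb{R}^n$ stand for the point $g+Qx$. Let $F:\mathbb{R}^n\to\mathbb{R}^n$ be the cubic vector field $F(x)=Dx-\tfrac12\|x\|^2x$, with Jacobian $DF(x)=D-xx^T-\tfrac12\|x\|^2I$. Then the set of points $x\in\mathbb{R}^n$ at which the symmetric matrix $DF(x)$ has a repeated eigenvalue is exactly the union of the $n-1$ real sets \[ \Phi_k=\Bigl\{x\in\mathbb{R}^n:\ x_k=0,\ \sum_{j\ne k}\frac{x_j^2}{d_j-d_k}=1\Bigr\},\qquad k=2,\ldots,n, \] and these sets are exactly the real focal sets of $E$ in principal coordinates centered at $g$.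
   Context: The John ellipsoid of a simplex in $\mathbb{R}^n$ is the ellipsoid of maximal volume contained in it; for the simplex with vertices $v_0,\ldots,v_n$ it is the ellipsoid $\{g+x:x^TB^{-1}x\le1\}$ with $g$ and $B$ as in the claim. Its squared semiaxis lengths are the eigenvalues $d_1,\ldots,d_n$ of $B$. Here $DF(x)$ denotes the Jacobian matrix of $F$ at $x$. A real symmetric matrix has a repeated eigenvalue if some eigenvalue has multiplicity at least $2$. Focal sets: for an ellipsoid with equation $\sum_{j=1}^n x_j^2/d_j\le 1$ in principal coordinates centered at its center, with $d_1>\cdots>d_n>0$, the focal quadric (focal set) associated with the index $k\in\{1,\ldots,n\}$ is by definition the set $\{x\in\mathbb{R}^n: x_k=0,\ \sum_{j\neq k} x_j^2/(d_j-d_k)=1\}$. It corresponds to the singular parameter $t=d_k$ of the confocal family $\sum_j x_j^2/(d_j-t)=1$. The real focal sets are the nonempty sets among these, $k=1,\ldots,n$. *)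

(* Defs.v *)
(* Points of R^n are column vectors 'cV[R]_n; the
   coordinates 1..n are numbered from 0 by 'I_n. *)
From HB Require Import structures.
From mathcomp Require Export all_boot all_order all_algebra.
From mathcomp Require Export boolp classical_sets functions reals topology
  normedtype derive.

Set Implicit Arguments.
Unset Strict Implicit.
Unset Printing Implicit Defensive.

Import Order.TTheory GRing.Theory Num.Theory.
Import numFieldNormedType.Exports.
Local Open Scope classical_set_scope.
Local Open Scope ring_scope.

(* The library norm on matrices is the sup norm, hence this Euclidean one. *)
Definition sqnorm (R : realType) (n : nat) (x : 'cV[R]_n) : R :=
  \sum_(i < n) x i 0 ^+ 2.

Definition nondegenerate_simplex (R : realType) (n : nat)
    (v : 'I_n.+1 -> 'cV[R]_n) : bool :=
  free [seq v (lift ord0 i) - v ord0 | i : 'I_n].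

Definition simplex (R : realType) (n : nat) (v : 'I_n.+1 -> 'cV[R]_n) :
    set 'cV[R]_n :=
  [set p | exists w : 'I_n.+1 -> R,
    [/\ forall i, 0 <= w i, \sum_i w i = 1 & p = \sum_i w i *: v i]].

Definition posdefmx (R : realType) (n : nat) (M : 'M[R]_n) : Prop :=
  M^T = M /\ forall x : 'cV[R]_n, x != 0 -> 0 < (x^T *m M *m x) 0 0.

Definition ellipsoid (R : realType) (n : nat) (c : 'cV[R]_n) (M : 'M[R]_n) :
    set 'cV[R]_n :=
  [set c + x | x in [set x : 'cV[R]_n | (x^T *m invmx M *m x) 0 0 <= 1]].

(* For M positive definite, [ellipsoid c M] is the image of the Euclidean unit
   ball under y |-> c + M^(1/2) y, so its n-dimensional volume is that of the
   unit ball times the quantity below. *)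
Definition ellipsoid_relvol (R : realType) (n : nat) (M : 'M[R]_n) : R :=
  Num.sqrt (\det M).

Definition is_john_ellipsoid (R : realType) (n : nat) (K E : set 'cV[R]_n) :
    Prop :=
  exists (c : 'cV[R]_n) (M : 'M[R]_n),
    [/\ posdefmx M, E = ellipsoid c M, E `<=` K
      & forall (c' : 'cV[R]_n) (M' : 'M[R]_n), posdefmx M' ->
          ellipsoid c' M' `<=` K ->
          ellipsoid_relvol M' <= ellipsoid_relvol M].

Definition jacobian_mx (R : realType) (n : nat) (F : 'cV[R]_n -> 'cV[R]_n)
    (x : 'cV[R]_n) : 'M[R]_n :=
  \matrix_(i, j) 'D_(delta_mx j 0) (fun y : 'cV[R]_n => F y i 0) x.

(* Multiplicity is algebraic; for symmetric matrices it is also geometric. *)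
Definition has_repeated_eigenvalue (R : realType) (n : nat) (A : 'M[R]_n) :
    Prop :=
  exists2 a : R, eigenvalue A a & (2 <= mup a (char_poly A))%N.

Definition strictly_decreasing_pos (R : realType) (n : nat) (d : 'rV[R]_n) :
    Prop :=
  (forall i j : 'I_n, (i < j)%N -> d 0 j < d 0 i) /\ (forall i, 0 < d 0 i).

Definition focal_quadric (R : realType) (n : nat) (d : 'rV[R]_n) (k : 'I_n) :
    set 'cV[R]_n :=
  [set x | x k 0 = 0 /\
     \sum_(j < n | j != k) x j 0 ^+ 2 / (d 0 j - d 0 k) = 1].

(* P is an ellipsoid already expressed in principal coordinates centered at its
   center; the squared semiaxes d are determined by P. *)
Definition real_focal_sets (R : realType) (n : nat) (P : set 'cV[R]_n) :
    set (set 'cV[R]_n) :=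
  [set S | exists d : 'rV[R]_n,
    [/\ strictly_decreasing_pos d,
        P = [set x | \sum_(j < n) x j 0 ^+ 2 / d 0 j <= 1],
        S !=set0
      & exists k : 'I_n, S = focal_quadric d k]].

(* Main.v *)
Require Import Defs.
From mathcomp Require Import all_boot all_order all_algebra.
From mathcomp Require Import boolp classical_sets functions reals topology
  normedtype derive.
From mathcomp Require Import ring lra.
Import Order.TTheory GRing.Theory Num.Theory.
Import numFieldNormedType.Exports.
Local Open Scope classical_set_scope.
Local Open Scope ring_scope.

Set Implicit Arguments.
Unset Strict Implicit.

(** Write m = n + 1 and factor B = W W^T with W = Q D^(1/2). In the coordinates
    y of the point g + W y, the ellipsoid E is the unit ball, the matrix with
    columns t_i = W^-1 u_i satisfies T T^T = n m I by the very definition of B,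
    and the t_i have sum zero. Together with a row of ones T is, up to scaling,
    an orthogonal matrix, hence t_i^T t_j = n m [i = j] - n: the simplex is
    regular ([gram_regular_simplex]) and its facets are n + t_i^T y = 0, where
    each t_i has norm n. So the unit ball is inscribed. An ellipsoid in the
    simplex is z + L (ball) with L lower triangular and positive on the diagonal
    ([cholesky]); the facet inequalities at y = - t_i / n, the point of the ball
    closest to the i-th facet, read 0 <= n + t_i^T z - t_i^T L t_i / n, and
    their sum gives tr L <= n. By the inequality between arithmetic and geometric
    means det L <= 1 ([trig_det_le1]), which is the maximality of E
    ([john_ellipsoid_simplex]).

    The Jacobian of F at x is, up to a multiple of the identity, the rank one
    perturbation diag d - x x^T, with characteristic polynomial
    prod_j (t - d_j) (1 + sum_k x_k^2 / (t - d_k))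
    ([char_poly_diag_sub_rank1]). The second factor is strictly monotone between
    its poles unless x = 0, so a double root must be some d_k, which forces
    x_k = 0 ([double_root_secular]); then d_k is a root once more exactly when
    sum_(j != k) x_j^2 / (d_j - d_k) = 1 ([double_root_secular_focal]), which is
    the k-th focal quadric. For the longest semiaxis all the terms of the sum
    are nonpositive and the quadric is empty, while the others are nonempty
    ([focal_quadric_nonempty]). *)

(** * Ellipsoids as images of the unit ball *)

Lemma sqnormE (R : realType) n (x : 'cV[R]_n) : (x^T *m x) 0 0 = sqnorm x.
Proof. by rewrite mxE; apply: eq_bigr => i _; rewrite mxE expr2. Qed.

Lemma sqnorm_ge0 (R : realType) n (x : 'cV[R]_n) : 0 <= sqnorm x.
Proof. by apply: sumr_ge0 => i _; rewrite sqr_ge0. Qed.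

Lemma sqnorm_gt0 (R : realType) n (x : 'cV[R]_n) : x != 0 -> 0 < sqnorm x.
Proof.
move=> x0; rewrite lt_neqAle sqnorm_ge0 andbT eq_sym; apply: contra x0.
rewrite psumr_eq0 => [/allP x0|i _]; last by rewrite sqr_ge0.
apply/eqP/matrixP => i j; rewrite (ord1 j) mxE.
by have /(_ (mem_index_enum i))/= := x0 i; rewrite sqrf_eq0 => /eqP.
Qed.

Lemma posdefmx_gram (R : realType) n (W : 'M[R]_n) :
  W \in unitmx -> posdefmx (W *m W^T).
Proof.
move=> Wu; split; first by rewrite trmx_mul trmxK.
move=> x x0; have -> : x^T *m (W *m W^T) *m x = (W^T *m x)^T *m (W^T *m x).
  by rewrite trmx_mul trmxK !mulmxA.
rewrite sqnormE; apply: sqnorm_gt0; apply: contra x0 => /eqP e.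
by rewrite -[x](mulKmx (_ : W^T \in unitmx)) ?unitmx_tr// e mulmx0.
Qed.

(** A factorisation M = W W^T turns the ellipsoid of M into the image of the
    unit ball under W, because x^T M^-1 x is the squared norm of W^-1 x. The
    factor W need not be symmetric, so no matrix square root is involved. *)
Lemma ellipsoid_gram (R : realType) n (c : 'cV[R]_n) (W : 'M[R]_n) :
  W \in unitmx ->
  ellipsoid c (W *m W^T) = [set c + W *m y | y in [set y | sqnorm y <= 1]].
Proof.
move=> Wu; have WTu : W^T \in unitmx by rewrite unitmx_tr.
have iE : invmx (W *m W^T) = (invmx W)^T *m invmx W.
  have WWu : W *m W^T \in unitmx by rewrite unitmx_mul Wu.
  apply: (can_inj (mulKmx WWu)); rewrite mulmxV//.
  by rewrite mulmxA -(mulmxA W) trmx_inv mulmxV// mulmx1 mulmxV.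
have E y : ((W *m y)^T *m invmx (W *m W^T) *m (W *m y)) 0 0 = sqnorm y.
  by rewrite iE trmx_mul !mulmxA trmx_inv mulmxK// mulmxKV// sqnormE.
apply/seteqP; split => [_ [x /= xE <-]|_ [y /= yE <-]].
  exists (invmx W *m x) => /=; last by rewrite mulKVmx.
  by rewrite -E mulKVmx.
by exists (W *m y) => //=; rewrite E.
Qed.

(** Induction on the size, splitting off the first row and column: the Schur
    complement of the top left entry is again positive definite. *)
Lemma cholesky (R : realType) n (M : 'M[R]_n) : posdefmx M ->
  exists L : 'M[R]_n,
    [/\ is_trig_mx L, forall i, 0 < L i i & L *m L^T = M].
Proof.
elim: n M => [|n IH] M.
  exists 0; split=> [|[]|] //; first exact: mx0_is_trig.
  by apply/matrixP => -[].
rewrite -[n.+1]/(1 + n)%N in M * => -[Msym Mpos].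
pose a := M 0 0; pose b := dlsubmx M; pose M1 := drsubmx M.
have ME : M = block_mx a%:M b^T b M1.
  rewrite -[LHS]submxK; congr block_mx.
    rewrite [LHS]mx11_scalar; congr _%:M; rewrite !mxE.
    by congr (M _ _); exact: val_inj.
  by rewrite -[in LHS]Msym; apply/matrixP => i j; rewrite !mxE.
have M1sym : M1^T = M1 by apply/matrixP => i j; rewrite !mxE -[in LHS]Msym mxE.
have q (s : R) (y : 'cV[R]_n) : ((col_mx s%:M y)^T *m M *m col_mx s%:M y) 0 0
    = s ^+ 2 * a + 2 * s * (b^T *m y) 0 0 + (y^T *m M1 *m y) 0 0.
  rewrite ME tr_col_mx mul_row_block mul_row_col tr_scalar_mx !mulmxDl.
  rewrite !mul_scalar_mx !mul_mx_scalar -scalemxAl.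
  have -> : y^T *m b = (b^T *m y)^T by rewrite trmx_mul trmxK.
  rewrite !mxE eqxx mulr1n; ring.
have a0 : 0 < a.
  have := Mpos (col_mx 1%:M 0) _; rewrite q !mulmx0 mxE.
  rewrite !(mulr0, mul1r, addr0, expr1n); apply.
  apply/eqP => /(congr1 usubmx); rewrite col_mxKu linear0.
  by move=> /matrixP/(_ 0 0)/eqP; rewrite !mxE eqxx oner_eq0.
have [|L1 [L1t L1p L1E]] := IH (M1 - a^-1 *: (b *m b^T)).
  split; first by rewrite linearB/= linearZ/= trmx_mul trmxK M1sym.
  (* The top entry - a^-1 b^T y minimises the quadratic form given y, and the
     minimum is the form of the Schur complement. *)
  move=> y y0; have := Mpos (col_mx (- a^-1 * (b^T *m y) 0 0)%:M y) _.
  rewrite q => H; set t := (b^T *m y) 0 0 in H *.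
  have -> : (y^T *m (M1 - a^-1 *: (b *m b^T)) *m y) 0 0 =
      (y^T *m M1 *m y) 0 0 - a^-1 * t ^+ 2.
    rewrite mulmxBr mulmxBl -scalemxAr -scalemxAl mulmxA -(mulmxA _ b^T).
    have -> : y^T *m b = (b^T *m y)^T by rewrite trmx_mul trmxK.
    rewrite [b^T *m y]mx11_scalar -/t tr_scalar_mx -scalar_mxM !mxE.
    by rewrite eqxx mulr1n expr2.
  have -> : (y^T *m M1 *m y) 0 0 - a^-1 * t ^+ 2 =
      (- a^-1 * t) ^+ 2 * a + 2 * (- a^-1 * t) * t + (y^T *m M1 *m y) 0 0.
    by field; rewrite gt_eqF.
  apply: H; apply: contra y0 => /eqP e.
  by rewrite -[y](col_mxKd (- a^-1 * t)%:M) e linear0.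
pose r := Num.sqrt a.
have r0 : 0 < r by rewrite sqrtr_gt0.
have rr : r * r = a by rewrite -expr2 sqr_sqrtr// ltW.
exists (block_mx r%:M 0 (r^-1 *: b) L1); split.
- by rewrite is_trig_block_mx// L1t eqxx scalar_mx_is_trig.
- move=> i; case: (split_ordP i) => j ->.
    by rewrite block_mxEul !mxE eqxx.
  by rewrite block_mxEdr.
- rewrite tr_block_mx mulmx_block ME tr_scalar_mx !trmx0.
  rewrite !(mulmx0, mul0mx, addr0).
  rewrite -!scalar_mxM rr L1E mul_scalar_mx mul_mx_scalar linearZ/= !scalerA.
  rewrite divff ?gt_eqF// !scale1r -scalemxAl -scalemxAr scalerA.
  by rewrite -invfM rr addrC subrK.
Qed.

(** * The regular simplex and its inscribed ball *)

(** The columns are the vertices of a regular simplex centred at the origin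
    with inradius 1 and circumradius n. The second moment and the barycentre
    are used as the definition because they are what an affine normalisation
    of an arbitrary simplex provides directly; the mutual position of the
    vertices follows from them in [gram_regular_simplex]. *)
Definition regular_simplex_mx (R : realType) n (T : 'M[R]_(n, n.+1)) : Prop :=
  T *m T^T = (n%:R * n.+1%:R)%:M /\ T *m (const_mx 1 : 'cV_n.+1) = 0.

Lemma gram_regular_simplex (R : realType) n (T : 'M[R]_(n, n.+1)) :
  (0 < n)%N -> regular_simplex_mx T ->
  T^T *m T = (n%:R * n.+1%:R)%:M - const_mx n%:R.
Proof.
move=> n0 [hT h1]; set c : R := n%:R * n.+1%:R.
have c0 : c != 0 by rewrite mulf_neq0// pnatr_eq0// -lt0n.
(* A row of ones on top of T makes it square, with orthogonal rows; a right
   inverse is then a left inverse, which gives the products of columns. *)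
pose S : 'M[R]_(1 + n, n.+1) := col_mx (const_mx 1) T.
pose S' : 'M[R]_(n.+1, 1 + n) := row_mx (const_mx n%:R) T^T.
have SS' : S *m (c^-1 *: S') = 1%:M.
  rewrite -scalemxAr mul_col_row hT.
  have -> : T *m const_mx n%:R = 0 :> 'cV[R]_n.
    have -> : const_mx n%:R = n%:R *: const_mx 1 :> 'cV[R]_n.+1.
      by apply/matrixP => i j; rewrite !mxE mulr1.
    by rewrite -scalemxAr h1 scaler0.
  have -> : const_mx 1 *m T^T = 0 :> 'rV[R]_n.
    by rewrite -[LHS]trmxK trmx_mul trmxK trmx_const h1 trmx0.
  have -> : const_mx 1 *m (const_mx n%:R : 'cV_n.+1) = c%:M :> 'M[R]_1.
    rewrite [LHS]mx11_scalar; congr _%:M; rewrite mxE.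
    under eq_bigr do rewrite !mxE mul1r.
    by rewrite sumr_const card_ord -[LHS]mulr_natr.
  by rewrite -scalar_mx_block scale_scalar_mx mulVf.
have := mulmx1C SS'; rewrite -scalemxAl mul_row_col => e.
have {e} : (const_mx n%:R : 'cV_n.+1) *m const_mx 1 + T^T *m T = c%:M
    :> 'M[R]_n.+1.
  by rewrite -[LHS](scalerKV c0) e scale_scalar_mx mulr1.
move=> <-; apply/eqP; rewrite eq_sym subr_eq addrC; apply/eqP.
congr (_ + _); apply/matrixP => i j.
by rewrite !mxE big_ord1 !mxE mulr1.
Qed.

Lemma sqnorm_simplex_vertex (R : realType) n (T : 'M[R]_(n, n.+1)) i :
  (0 < n)%N -> regular_simplex_mx T ->
  sqnorm (col i T) = n%:R ^+ 2.
Proof.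
move=> n0 hT; have /matrixP/(_ i i) := gram_regular_simplex n0 hT.
rewrite !mxE eqxx mulr1n -natr1 => e.
transitivity (\sum_j T^T i j * T j i).
  by apply: eq_bigr => j _; rewrite !mxE expr2.
by rewrite e; ring.
Qed.

(** If t is a vertex, its squared norm is n^2, and expanding the nonnegative
    squared norm of t + n y gives the bound on the product of t and y. *)
Lemma unit_ball_halfspaces (R : realType) n (T : 'M[R]_(n, n.+1)) (y : 'cV_n)
    i :
  (0 < n)%N -> regular_simplex_mx T ->
  sqnorm y <= 1 -> 0 <= n%:R + (T^T *m y) i 0.
Proof.
move=> n0 hT y1.
have := sqnorm_ge0 (col i T + n%:R *: y).
have -> : sqnorm (col i T + n%:R *: y) =
    sqnorm (col i T) + 2 * n%:R * (T^T *m y) i 0 + n%:R ^+ 2 * sqnorm y.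
  rewrite mxE !mulr_sumr -!big_split/=; apply: eq_bigr => k _.
  by rewrite !mxE; ring.
rewrite sqnorm_simplex_vertex//; set s := (T^T *m y) i 0.
have n1 : 0 < n%:R :> R by rewrite ltr0n.
have : n%:R ^+ 2 * sqnorm y <= n%:R ^+ 2 :> R by rewrite ler_piMr// sqr_ge0.
move=> ? ?; rewrite -(pmulr_rge0 _ n1); nra.
Qed.

Lemma sum_mulTmx (R : realType) n (T : 'M[R]_(n, n.+1)) (y : 'cV_n) :
  regular_simplex_mx T -> \sum_i (T^T *m y) i 0 = 0.
Proof.
move=> [_ h1]; transitivity ((const_mx 1 *m (T^T *m y) : 'M_1) 0 0).
  by rewrite [RHS]mxE; apply: eq_bigr => i _; rewrite [const_mx _ _ _]mxE mul1r.
by rewrite mulmxA -[const_mx 1]trmxK trmx_const -trmx_mul h1 trmx0 mul0mx mxE.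
Qed.

(** The barycentric coordinates of g + W y are n + t_i y, up to the factor
    n (n + 1), where t_i is the i-th column of T. *)
Lemma simplex_halfspaces (R : realType) n (v : 'I_n.+1 -> 'cV[R]_n)
    (g y : 'cV[R]_n) (W : 'M[R]_n) (T : 'M[R]_(n, n.+1)) :
  (0 < n)%N -> W \in unitmx -> regular_simplex_mx T ->
  (forall i, v i = g + W *m col i T) ->
  simplex v (g + W *m y) <-> forall i, 0 <= n%:R + (T^T *m y) i 0.
Proof.
move=> n0 Wu hT vE; have [hTT h1] := hT.
have n1 : n%:R != 0 :> R by rewrite pnatr_eq0 -lt0n.
have c0 : 0 < n%:R * n.+1%:R :> R by rewrite mulr_gt0// ltr0n.
have barE (w : 'I_n.+1 -> R) : \sum_i w i = 1 ->
    \sum_i w i *: v i = g + W *m (T *m \col_i w i).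
  move=> w1; under eq_bigr do rewrite vE scalerDr.
  rewrite big_split/= -scaler_suml w1 scale1r; congr (_ + _).
  under eq_bigr do rewrite scalemxAr.
  rewrite -mulmx_sumr; congr (_ *m _); apply/matrixP => i j.
  rewrite summxE mxE; apply: eq_bigr => k _; rewrite !mxE; ring.
split=> [[w [w0 w1]]|h].
  rewrite barE// => /addrI/(can_inj (mulKmx Wu)) -> i.
  rewrite mulmxA gram_regular_simplex// mulmxBl mul_scalar_mx !mxE.
  under eq_bigr do rewrite !mxE.
  by rewrite -mulr_sumr w1 mulr1 [leRHS]addrC subrK mulr_ge0// ltW.
exists (fun i => (n%:R * n.+1%:R)^-1 * (n%:R + (T^T *m y) i 0)).
have w1 : \sum_i (n%:R * n.+1%:R)^-1 * (n%:R + (T^T *m y) i 0) = 1.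
  rewrite -mulr_sumr big_split/= sum_mulTmx// addr0 sumr_const card_ord.
  by rewrite -[n%:R *+ _]mulr_natr mulVf// gt_eqF.
split=> // [i|]; first by rewrite mulr_ge0// invr_ge0 ltW.
rewrite barE//; congr (_ + _ *m _).
have -> : \col_i ((n%:R * n.+1%:R)^-1 * (n%:R + (T^T *m y) i 0)) =
   (n%:R * n.+1%:R)^-1 *: (n%:R *: const_mx 1 + T^T *m y).
  by apply/matrixP => i j; rewrite (ord1 j) !mxE mulr1.
rewrite -scalemxAr mulmxDr -scalemxAr h1 scaler0 add0r mulmxA hTT mul_scalar_mx.
by rewrite scalerA mulVf ?gt_eqF// scale1r.
Qed.

(** Testing the facet inequalities at the contact points of the unit ball and
    adding them up bounds the trace of L by n. The determinant of L is the
    product of its positive diagonal entries, so the inequality between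
    arithmetic and geometric means concludes. *)
Lemma trig_det_le1 (R : realType) n (T : 'M[R]_(n, n.+1)) (z : 'cV[R]_n)
    (L : 'M[R]_n) :
  (0 < n)%N -> regular_simplex_mx T ->
  is_trig_mx L -> (forall i, 0 < L i i) ->
  (forall y, sqnorm y <= 1 ->
     forall i, 0 <= n%:R + (T^T *m (z + L *m y)) i 0) ->
  0 < \det L <= 1.
Proof.
move=> n0 hT Lt Lp hL.
have n1 : 0 < n%:R :> R by rewrite ltr0n.
have m1 : 0 < n.+1%:R :> R by rewrite ltr0n.
rewrite det_trig// prodr_gt0//=.
(* The point of the i-th facet touched by the unit ball is the opposite of the
   i-th vertex divided by n; the centre z disappears in the sum over i. *)
have /= trL : \tr L <= n%:R.
  have h i : 0 <= n%:R + (T^T *m z) i 0 - n%:R^-1 * (T^T *m L *m T) i i.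
    have := hL (- n%:R^-1 *: col i T) _ i.
    have -> : (T^T *m (z + L *m (- n%:R^-1 *: col i T))) i 0 =
        (T^T *m z) i 0 - n%:R^-1 * (T^T *m L *m T) i i.
      rewrite mulmxDr mulmxA -scalemxAr -[col i T]mulmx1 colE mulmx1 mulmxA.
      rewrite -colE.
      by rewrite !mxE mulNr.
    rewrite addrA; apply.
    have -> : sqnorm (- n%:R^-1 *: col i T) = n%:R^-1 ^+ 2 * sqnorm (col i T).
      by rewrite mulr_sumr; apply: eq_bigr => k _; rewrite !mxE exprMn sqrrN.
    by rewrite sqnorm_simplex_vertex// -exprMn mulVf ?expr1n// gt_eqF.
  have : 0 <= \sum_i (n%:R + (T^T *m z) i 0 - n%:R^-1 * (T^T *m L *m T) i i).
    by apply: sumr_ge0.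
  rewrite sumrB big_split/= sum_mulTmx// addr0 -mulr_sumr sumr_const card_ord.
  rewrite -/(\tr (T^T *m L *m T)) -mulmxA mxtrace_mulC -mulmxA hT.1.
  rewrite mul_mx_scalar.
  rewrite mxtraceZ -[n%:R *+ _]mulr_natr !mulrA mulVf ?gt_eqF// mul1r.
  by rewrite mulrC -mulrBr pmulr_rge0// subr_ge0.
have := @leif_AGM R 'I_n predT (fun i => L i i) (fun i _ => ltW (Lp i)).
move=> /= [+ _]; rewrite card_ord => /le_trans; apply.
rewrite exprn_ile1// ?divr_ge0//.
  by rewrite sumr_ge0// => i _; exact: ltW.
by rewrite ler_pdivrMr// mul1r.
Qed.

Lemma posdefmx_congr (R : realType) n (M V : 'M[R]_n) :
  V \in unitmx -> posdefmx M -> posdefmx (V *m M *m V^T).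
Proof.
move=> Vu [Ms Mp]; split; first by rewrite !trmx_mul trmxK Ms mulmxA.
move=> x x0; have := Mp (V^T *m x) _; rewrite trmx_mul trmxK !mulmxA; apply.
apply: contra x0 => /eqP e.
by rewrite -[x](mulKmx (_ : V^T \in unitmx)) ?unitmx_tr// e mulmx0.
Qed.

(** In the coordinates y of g + W y the claim is that no ellipsoid in the
    regular simplex has a larger volume than the unit ball. A competing
    ellipsoid is z + L (ball) with L triangular, by [cholesky], and
    [trig_det_le1] applies. *)
Lemma john_ellipsoid_simplex (R : realType) n (v : 'I_n.+1 -> 'cV[R]_n)
    (g : 'cV[R]_n) (W : 'M[R]_n) (T : 'M[R]_(n, n.+1)) :
  (0 < n)%N -> W \in unitmx -> regular_simplex_mx T ->
  (forall i, v i = g + W *m col i T) ->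
  is_john_ellipsoid (simplex v) (ellipsoid g (W *m W^T)).
Proof.
move=> n0 Wu hT vE; exists g, (W *m W^T); split=> //.
- exact: posdefmx_gram.
- rewrite ellipsoid_gram// => _ [y /= y1 <-].
  apply/(simplex_halfspaces y n0 Wu hT vE) => i.
  exact: unit_ball_halfspaces.
move=> c' M' M'p; have Wiu : invmx W \in unitmx by rewrite unitmx_inv.
have [L [Lt Lp LE]] := cholesky (posdefmx_congr Wiu M'p).
have M'E : M' = (W *m L) *m (W *m L)^T.
  rewrite trmx_mul mulmxA -(mulmxA W) LE !mulmxA mulmxV// mul1mx.
  by rewrite trmx_inv mulmxKV// unitmx_tr.
have Lu : L \in unitmx.
  by rewrite unitmxE det_trig// unitfE gt_eqF// prodr_gt0.
rewrite M'E ellipsoid_gram ?unitmx_mul ?Wu// => sub.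
have /andP[dL0 dL1] : 0 < \det L <= 1.
  apply: (@trig_det_le1 _ _ T (invmx W *m (c' - g))) => // y y1 i.
  apply: (proj1 (simplex_halfspaces _ n0 Wu hT vE)) i.
  rewrite mulmxDr mulKVmx// addrA (addrC g) subrK mulmxA.
  by apply: sub; exists y.
rewrite /ellipsoid_relvol ler_wsqrtr// !det_mulmx !det_tr det_mulmx.
rewrite mulrACA -[leRHS]mulr1 ler_wpM2l// -?expr2 ?sqr_ge0//.
by rewrite expr_le1// ltW.
Qed.

(** * Double eigenvalues of a rank one perturbation of a diagonal matrix *)

(** Both sides are the determinant of one block matrix, eliminated in the two
    possible orders. *)
Lemma det_1_add_mulC (R : comPzRingType) m n (u : 'M[R]_(m, n))
    (w : 'M[R]_(n, m)) :
  \det (1%:M + u *m w) = \det (1%:M + w *m u).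
Proof.
pose M := block_mx 1%:M (- u) w 1%:M.
have e1 : M = block_mx 1%:M 0 w 1%:M *m block_mx 1%:M (- u) 0 (1%:M + w *m u).
  rewrite mulmx_block !(mul1mx, mulmx1, mul0mx, mulmx0, addr0, add0r).
  by rewrite mulmxN addrC addrK.
have e2 : M = block_mx 1%:M (- u) 0 1%:M *m block_mx (1%:M + u *m w) 0 w 1%:M.
  rewrite mulmx_block !(mul1mx, mulmx1, mul0mx, mulmx0, addr0, add0r).
  by rewrite mulNmx addrK.
have := congr1 determinant e2; rewrite e1 !det_mulmx !det_ublock !det_lblock.
by rewrite !det1 !mul1r !mulr1.
Qed.

Lemma det_diag_add_rank1 (F : fieldType) n (a : 'rV[F]_n) (x : 'cV[F]_n) :
  (forall j, a 0 j != 0) ->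
  \det (diag_mx a + x *m x^T) =
    (\prod_j a 0 j) * (1 + \sum_k x k 0 ^+ 2 / a 0 k).
Proof.
move=> a0; pose y : 'cV[F]_n := \col_k (x k 0 / a 0 k).
have -> : x = diag_mx a *m y.
  apply/matrixP => i j; rewrite (ord1 j) mul_diag_mx !mxE mulrC divfK//.
rewrite -[X in X + _]mulmx1 -mulmxA -mulmxDr det_mulmx det_diag; congr (_ * _).
rewrite det_1_add_mulC det_mx11 !mxE eqxx mulr1n; congr (_ + _).
apply: eq_bigr => k _; rewrite mul_diag_mx !mxE.
by field.
Qed.

(** The numerator of the secular function 1 + sum_k x_k^2 / (t - d_k), written
    over the common denominator prod_j (t - d_j). *)
Definition secular_poly (F : fieldType) n (d : 'rV[F]_n) (x : 'cV[F]_n) :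
    {poly F} :=
  \prod_j ('X - (d 0 j)%:P) +
  \sum_k x k 0 ^+ 2 *: \prod_(j | j != k) ('X - (d 0 j)%:P).

Lemma poly_eq_off_roots (F : numFieldType) (p q r : {poly F}) :
  r != 0 -> (forall t, ~~ root r t -> p.[t] = q.[t]) -> p = q.
Proof.
move=> r0 h; apply/eqP; rewrite -subr_eq0 -(mulIr_eq0 _ (mulIf r0)).
pose rs : seq F := [seq i%:R | i <- iota 0 (size ((p - q) * r))].
apply/eqP; apply: (@roots_geq_poly_eq0 _ _ rs).
- apply/allP => t _; rewrite rootM.
  case: (boolP (root r t)) => rt; rewrite ?orbT// orbF.
  by rewrite rootE !hornerE h// subrr.
- by rewrite map_inj_uniq ?iota_uniq//; apply: mulrIn; rewrite oner_eq0.
- by rewrite size_map size_iota.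
Qed.

(** Off the d_j the matrix t - diag d is invertible, and [det_diag_add_rank1]
    evaluates the characteristic polynomial; polynomials over an infinite field
    that agree there are equal. *)
Lemma char_poly_diag_sub_rank1 (F : numFieldType) n (d : 'rV[F]_n)
    (x : 'cV[F]_n) :
  char_poly (diag_mx d - x *m x^T) = secular_poly d x.
Proof.
pose P := \prod_j ('X - (d 0 j)%:P).
apply: (@poly_eq_off_roots _ _ _ P).
  by rewrite monic_neq0// monic_prod_XsubC.
move=> t tP; have td j : t - d 0 j != 0.
  apply: contra tP => /eqP e; rewrite rootE horner_prod (bigD1 j)//= !hornerE e.
  by rewrite mul0r.
have -> : (char_poly (diag_mx d - x *m x^T)).[t] =
    \det (diag_mx (const_mx t - d) + x *m x^T).
  rewrite -horner_evalE -det_map_mx; congr (\det _); apply/matrixP => i j.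
  rewrite !mxE /= horner_evalE !hornerE hornerMn hornerX mulrnBl.
  by rewrite opprB addrA addrAC.
rewrite det_diag_add_rank1 => [|j]; last by rewrite !mxE.
rewrite /secular_poly hornerD horner_prod horner_sum mulrDr mulr1.
congr (_ + _).
  by apply: eq_bigr => j _; rewrite !mxE !hornerE.
rewrite mulr_sumr; apply: eq_bigr => k _.
rewrite hornerZ horner_prod (bigD1 k)//= !mxE.
rewrite mulrC mulrA divfK//; congr (_ * _).
by apply: eq_bigr => j _; rewrite !mxE !hornerE.
Qed.

(** Away from the d_j the derivative of the secular function is
    - sum_k x_k^2 / (t - d_k)^2, which vanishes only for x = 0, when the
    function itself is 1. So a double root is some d_k, and the value of the secular
    polynomial at d_k is x_k^2 times a nonzero number. *)
Lemma double_root_secular (F : realFieldType) n (d : 'rV[F]_n)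
    (x : 'cV[F]_n) a :
  injective (d 0) ->
  ('X - a%:P) ^+ 2 %| secular_poly d x ->
  exists2 k, a = d 0 k & x k 0 = 0.
Proof.
move=> dI dv.
pose P := \prod_j ('X - (d 0 j)%:P).
pose Pk k := \prod_(j | j != k) ('X - (d 0 j)%:P).
have PE k : P = ('X - (d 0 k)%:P) * Pk k by rewrite /P (bigD1 k).
have pa : (secular_poly d x).[a] = 0.
  have /dvdp_trans/(_ dv) : 'X - a%:P %| ('X - a%:P) ^+ 2.
    by rewrite expr2 dvdp_mulr.
  by rewrite dvdp_XsubCl => /rootP.
(* Polynomial form of the fact that the difference quotients of the secular
   function 1 + sum_k x_k^2 / (t - d_k) are negative sums of the terms
   x_k^2 / ((t - d_k) (a - d_k)). *)
have key : P.[a] *: secular_poly d x - (secular_poly d x).[a] *: P =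
    ('X - a%:P) * - \sum_k (x k 0 ^+ 2 * (Pk k).[a]) *: Pk k.
  rewrite /secular_poly -/P scalerDr hornerD horner_sum scalerDl opprD.
  rewrite addrACA subrr add0r scaler_sumr scaler_suml -sumrB.
  rewrite mulrN mulr_sumr -sumrN.
  apply: eq_bigr => k _; rewrite -/(Pk k) (PE k) hornerM hornerXsubC hornerZ.
  by rewrite -!mul_polyC !polyCM polyCB; ring.
have sq0 : \sum_k (x k 0 * (Pk k).[a]) ^+ 2 = 0.
  have : ('X - a%:P) ^+ 2 %|
      ('X - a%:P) * \sum_k (x k 0 ^+ 2 * (Pk k).[a]) *: Pk k.
    by rewrite -dvdpNr -mulrN -key pa scale0r subr0 -mul_polyC dvdp_mull.
  rewrite expr2 dvdp_mul2l ?polyXsubC_eq0// dvdp_XsubCl => /rootP.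
  rewrite horner_sum => e; rewrite -[RHS]e; apply: eq_bigr => k _.
  by rewrite hornerZ exprMn mulrA.
have xP k : x k 0 * (Pk k).[a] = 0.
  move/eqP: sq0; rewrite psumr_eq0 => [/allP/(_ k (mem_index_enum k))/=|i _].
    by rewrite sqrf_eq0 => /eqP.
  exact: sqr_ge0.
have : P.[a] = 0.
  move: pa; rewrite /secular_poly -/P hornerD horner_sum big1 ?addr0// => k _.
  by rewrite hornerZ expr2 -mulrA xP mulr0.
rewrite horner_prod => /eqP/prodf_eq0[k _].
rewrite hornerXsubC subr_eq0 => /eqP ak.
exists k => //; move/eqP: (xP k); rewrite mulf_eq0 => /orP[/eqP//|].
rewrite horner_prod => /prodf_eq0[j jk]; rewrite hornerXsubC subr_eq0 ak.
by rewrite (inj_eq dI) eq_sym (negbTE jk).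
Qed.

(** When x_k = 0 the factor t - d_k splits off; the cofactor takes at d_k a
    value that is a nonzero product times the defect of the focal equation. *)
Lemma double_root_secular_focal (F : realFieldType) n (d : 'rV[F]_n)
    (x : 'cV[F]_n) k :
  injective (d 0) -> x k 0 = 0 ->
  (('X - (d 0 k)%:P) ^+ 2 %| secular_poly d x) =
  (\sum_(j | j != k) x j 0 ^+ 2 / (d 0 j - d 0 k) == 1).
Proof.
move=> dI xk.
pose q := \prod_(j | j != k) ('X - (d 0 j)%:P) +
  \sum_(l | l != k)
    x l 0 ^+ 2 *: \prod_(j | (j != k) && (j != l)) ('X - (d 0 j)%:P).
have -> : secular_poly d x = ('X - (d 0 k)%:P) * q.
  rewrite /secular_poly (bigD1 k)//= mulrDr; congr (_ + _).
  rewrite (bigD1 k)//= xk expr0n scale0r add0r mulr_sumr.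
  apply: eq_bigr => l lk; rewrite -scalerAr; congr (_ *: _).
  rewrite (bigD1 k) 1?eq_sym//=; congr (_ * _).
  by apply: eq_bigl => j; rewrite andbC.
rewrite expr2 dvdp_mul2l ?polyXsubC_eq0// dvdp_XsubCl rootE.
have dk j : j != k -> d 0 k - d 0 j != 0.
  by move=> jk; rewrite subr_eq0 (inj_eq dI) eq_sym.
have -> : q.[d 0 k] = \prod_(j | j != k) (d 0 k - d 0 j) *
    (1 - \sum_(j | j != k) x j 0 ^+ 2 / (d 0 j - d 0 k)).
  rewrite hornerD horner_prod horner_sum mulrBr mulr1 -mulrN.
  congr (_ + _); first by apply: eq_bigr => j _; rewrite hornerXsubC.
  rewrite -sumrN mulr_sumr; apply: eq_bigr => l lk; rewrite hornerZ horner_prod.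
  rewrite [in RHS](bigD1 l)//= -mulrN -invrN opprB.
  under eq_bigr do rewrite hornerXsubC.
  by field; exact: dk.
rewrite mulf_eq0 prodf_seq_eq0 subr_eq0 [in RHS]eq_sym.
case: hasP => //= -[j _ /andP[jk]]; by rewrite (negbTE (dk j jk)).
Qed.

Lemma repeated_eigenvalue_focal (R : realType) n (d : 'rV[R]_n) (x : 'cV[R]_n) :
  injective (d 0) ->
  has_repeated_eigenvalue (diag_mx d - x *m x^T) <->
  exists k, focal_quadric d k x.
Proof.
move=> dI; have cE := char_poly_diag_sub_rank1 d x.
have c0 : secular_poly d x != 0 by rewrite -cE monic_neq0// char_poly_monic.
split=> [[a _]|[k [xk sk]]].
  rewrite cE mup_geq// => dv; have [k ak xk] := double_root_secular dI dv.
  exists k; split => //; apply/eqP.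
  by rewrite -double_root_secular_focal// -ak.
set A := diag_mx d - x *m x^T in cE *; pose a := d 0 k.
have dv : (2 <= mup a (char_poly A))%N.
  by rewrite cE mup_geq// double_root_secular_focal// sk.
exists a => //; rewrite eigenvalue_root_char.
by rewrite -dvdp_XsubCl XsubC_dvd ?cE// -cE ltnW.
Qed.

(** * The Jacobian of the cubic vector field *)

Lemma is_derive_coord (R : realType) n (x v : 'cV[R]_n) i :
  is_derive x v (fun y : 'cV[R]_n => y i 0) (v i 0).
Proof.
have h : derivable (@id 'cV[R]_n) x v by exact: derivable_id.
split; first exact: (proj1 (derivable_mxP _ _ _) h).
have := derive_mx h.
by rewrite derive_id => /matrixP/(_ i 0); rewrite mxE.
Qed.

Definition cubic_field (R : realType) n (d : 'rV[R]_n) (x : 'cV[R]_n) :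
    'cV[R]_n :=
  diag_mx d *m x - (2^-1 * sqnorm x) *: x.

(** The components are combined from the coordinate functions by operations on
    functions, the form in which the rules of differentiation apply. *)
Lemma cubic_field_coord (R : realType) n (d : 'rV[R]_n) i :
  (fun y => cubic_field d y i 0) =
  d 0 i *: (fun y : 'cV[R]_n => y i 0) -
    (2^-1 *: \sum_(k < n) (fun y : 'cV[R]_n => y k 0) ^+ 2) *
    (fun y : 'cV[R]_n => y i 0).
Proof.
apply/funext => y; rewrite /cubic_field mxE mul_diag_mx !mxE.
pose s := (\sum_(k < n) (fun y : 'cV[R]_n => y k 0) ^+ 2) y.
rewrite -[RHS]/(d 0 i * y i 0 - 2^-1 * s * y i 0) /s.
by rewrite fct_sumE.
Qed.

Lemma differentiable_cubic_field (R : realType) n (d : 'rV[R]_n) x :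
  differentiable (cubic_field d) x.
Proof.
have -> : cubic_field d =
    \sum_(i < n) (fun y => cubic_field d y i 0 *: delta_mx i 0).
  apply/funext => y; rewrite fct_sumE [LHS]matrix_sum_delta.
  by apply: eq_bigr => i _; rewrite big_ord1.
apply: differentiable_sum => i; apply: differentiableZl.
rewrite cubic_field_coord.
apply: differentiableB.
  by apply: differentiableZ; exact: differentiable_coord.
apply: differentiableM; last exact: differentiable_coord.
apply: differentiableZ; apply: differentiable_sum => k.
by apply: differentiableX; exact: differentiable_coord.
Qed.

Lemma jacobian_cubic_field (R : realType) n (d : 'rV[R]_n) x :
  jacobian_mx (cubic_field d) x = diag_mx d - x *m x^T - (2^-1 * sqnorm x)%:M.
Proof.
apply/matrixP => i j; rewrite mxE cubic_field_coord.
have c k := is_derive_coord x (delta_mx j 0) k.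
rewrite derive_val.
have -> : (2^-1 *: \sum_(k < n) (fun y : 'cV[R]_n => y k 0) ^+ 2) x =
    2^-1 * sqnorm x.
  pose s := (\sum_(k < n) (fun y : 'cV[R]_n => y k 0) ^+ 2) x.
  by rewrite -[LHS]/(2^-1 * s) /s fct_sumE.
have -> : \sum_(k < n) (2 * x k 0 ^+ 2.-1) *: (delta_mx j 0 : 'cV[R]_n) k 0 =
    2 * x j 0.
  rewrite (bigD1 j)//= big1 => [|k kj]; rewrite mxE.
    by rewrite !eqxx addr0 [LHS]mulr1.
  by rewrite (negbTE kj) scaler0.
rewrite !mxE big_ord1 !mxE eqxx andbT /GRing.scale/=.
by case: eqP => [->|_]; rewrite ?mulr1n ?mulr0n; field.
Qed.

(** * Real focal sets of an ellipsoid *)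

Lemma strictly_decreasing_inj (R : realType) n (d : 'rV[R]_n) :
  strictly_decreasing_pos d -> injective (d 0).
Proof.
move=> [dd _] i j e; apply/val_inj/eqP; case: ltngtP => // /dd.
  by rewrite e ltxx.
by rewrite e ltxx.
Qed.

(** For the longest semiaxis all the denominators are negative, so the sum
    cannot reach 1. For any other index the quadric meets the axis of the
    longest semiaxis. *)
Lemma focal_quadric_nonempty (R : realType) n (d : 'rV[R]_n) (k : 'I_n) :
  strictly_decreasing_pos d -> focal_quadric d k !=set0 <-> (0 < k)%N.
Proof.
move=> [dd dp]; split=> [[x [_ xk]]|k0].
  rewrite lt0n; apply/eqP => k0.
  have : \sum_(j < n | j != k) x j 0 ^+ 2 / (d 0 j - d 0 k) <= 0.
    apply: sumr_le0 => j jk.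
    rewrite mulr_ge0_le0 ?sqr_ge0// invr_le0 subr_le0 ltW// dd//.
    by rewrite k0 lt0n -k0.
  by rewrite xk ler10.
have n0 : (0 < n)%N by apply: leq_ltn_trans (ltn_ord k).
pose i0 := Ordinal n0.
have i0k : i0 != k by rewrite -val_eqE /= neq_ltn k0.
have ki0 : k != i0 by rewrite eq_sym.
have dk : 0 < d 0 i0 - d 0 k by rewrite subr_gt0 dd.
exists (Num.sqrt (d 0 i0 - d 0 k) *: delta_mx i0 0); split.
  by rewrite !mxE (negbTE ki0) mulr0.
rewrite (bigD1 i0)//= big1 => [|j /andP[_ ji]].
  by rewrite !mxE !eqxx mulr1 sqr_sqrtr ?ltW// divff ?addr0// gt_eqF.
by rewrite !mxE (negbTE ji) mulr0 expr0n mul0r.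
Qed.

(** Inclusion of the solids is tested at the end point of the i-th semiaxis. *)
Lemma quadric_semiaxes_le (R : realType) n (d e : 'rV[R]_n) :
  (forall i, 0 < d 0 i) -> (forall i, 0 < e 0 i) ->
  [set x : 'cV[R]_n | \sum_j x j 0 ^+ 2 / d 0 j <= 1] `<=`
    [set x | \sum_j x j 0 ^+ 2 / e 0 j <= 1] ->
  forall i, d 0 i <= e 0 i.
Proof.
move=> dp ep sub i.
pose p : 'cV[R]_n := Num.sqrt (d 0 i) *: delta_mx i 0.
have S (c : 'rV[R]_n) : \sum_j p j 0 ^+ 2 / c 0 j = d 0 i / c 0 i.
  rewrite (bigD1 i)//= big1 => [|j ji].
    by rewrite !mxE !eqxx mulr1 sqr_sqrtr ?ltW// addr0.
  by rewrite !mxE (negbTE ji) mulr0 expr0n mul0r.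
have := sub p; rewrite /= !S divff ?gt_eqF//.
by rewrite ler_pdivrMr// mul1r; apply.
Qed.

(** The solid determines its ordered semiaxes, by [quadric_semiaxes_le] in both
    directions, so the focal sets can be read off from the given ones. *)
Lemma real_focal_setsE (R : realType) n (d : 'rV[R]_n) :
  strictly_decreasing_pos d ->
  real_focal_sets [set x : 'cV[R]_n | \sum_j x j 0 ^+ 2 / d 0 j <= 1] =
    [set focal_quadric d k | k in [set k : 'I_n | (0 < k)%N]].
Proof.
move=> hd; apply/seteqP; split=> [S [e [he P S0 [k Sk]]]|S [k /= k0 <-]].
  have de : d = e.
    apply/rowP => i; apply/eqP; rewrite eq_le.
    have [[_ dp] [_ ep]] := (hd, he).
    apply/andP; split; apply: quadric_semiaxes_le => //; first by rewrite P.
    by rewrite -[X in _ `<=` X]/[set x : 'cV[R]_n | _ <= _] P.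
  exists k; last by rewrite Sk de.
  by rewrite /= -(focal_quadric_nonempty _ he) -Sk.
by exists d; split=> //; [exact/focal_quadric_nonempty|exists k].
Qed.

Definition diag_sqrt (R : realType) n (d : 'rV[R]_n) : 'M[R]_n :=
  diag_mx (map_mx Num.sqrt d).

Lemma diag_sqrt_unitmx (R : realType) n (d : 'rV[R]_n) :
  (forall i, 0 < d 0 i) -> diag_sqrt d \in unitmx.
Proof.
move=> dp; rewrite unitmxE det_diag unitfE prodf_seq_neq0; apply/allP => i _.
by rewrite mxE gt_eqF// sqrtr_gt0.
Qed.

Lemma diag_sqrt_gram (R : realType) n (d : 'rV[R]_n) :
  (forall i, 0 < d 0 i) -> diag_sqrt d *m (diag_sqrt d)^T = diag_mx d.
Proof.
move=> dp; rewrite tr_diag_mx mulmx_diag; congr diag_mx.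
by apply/rowP => i; rewrite !mxE -expr2 sqr_sqrtr// ltW.
Qed.

Lemma ellipsoid_principal_coord (R : realType) n (d : 'rV[R]_n)
    (g : 'cV[R]_n) (Q : 'M[R]_n) :
  (forall i, 0 < d 0 i) -> Q \in unitmx ->
  let W := Q *m diag_sqrt d in
  [set x | ellipsoid g (W *m W^T) (g + Q *m x)] =
  [set x : 'cV[R]_n | \sum_j x j 0 ^+ 2 / d 0 j <= 1].
Proof.
move=> dp Qu W; have Su := diag_sqrt_unitmx dp.
rewrite ellipsoid_gram ?unitmx_mul ?Qu//.
have sE y : sqnorm y = \sum_j (diag_sqrt d *m y) j 0 ^+ 2 / d 0 j.
  apply: eq_bigr => j _; rewrite mul_diag_mx !mxE exprMn sqr_sqrtr ?ltW//.
  by rewrite mulrC mulrA mulVf ?mul1r// gt_eqF.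
apply/seteqP; split=> [x /= [y /= y1 /addrI]|x /= x1].
  by rewrite -mulmxA => /(can_inj (mulKmx Qu)) <-; rewrite -sE.
by exists (invmx (diag_sqrt d) *m x); rewrite /= ?sE /W -?mulmxA mulKVmx.
Qed.

(** * Normalisation of an arbitrary simplex *)

Lemma sum_col_mul_tr (R : realType) m n (u : 'I_m -> 'cV[R]_n) :
  \sum_i u i *m (u i)^T =
  (\matrix_(j, i) u i j 0) *m (\matrix_(j, i) u i j 0)^T.
Proof.
apply/matrixP => i j; rewrite summxE mxE; apply: eq_bigr => k _.
by rewrite !mxE big_ord1 !mxE.
Qed.

Theorem theorem1 (R : realType) (n : nat) (v : 'I_n.+1 -> 'cV[R]_n)
    (d : 'rV[R]_n) (Q : 'M[R]_n) :
  let g : 'cV[R]_n := (n.+1)%:R^-1 *: \sum_(i < n.+1) v i in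
  let u := fun i : 'I_n.+1 => v i - g in
  let B : 'M[R]_n :=
    (n%:R * (n.+1)%:R)^-1 *: \sum_(i < n.+1) u i *m (u i)^T in
  let E : set 'cV[R]_n := ellipsoid g B in
  let D : 'M[R]_n := diag_mx d in
  let F := fun x : 'cV[R]_n => D *m x - (2^-1 * sqnorm x) *: x in
  let Phi := fun k : 'I_n =>
    [set x : 'cV[R]_n | x k 0 = 0 /\
       \sum_(j < n | j != k) x j 0 ^+ 2 / (d 0 j - d 0 k) = 1] in
  (2 <= n)%N ->
  nondegenerate_simplex v ->
  strictly_decreasing_pos d ->
  Q^T *m Q = 1%:M ->
  Q^T *m B *m Q = D ->
  [/\ is_john_ellipsoid (simplex v) E,
      forall x : 'cV[R]_n, differentiable F x /\
        jacobian_mx F x = D - x *m x^T - (2^-1 * sqnorm x)%:M,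
      [set x : 'cV[R]_n | has_repeated_eigenvalue (jacobian_mx F x)]
        = \bigcup_(k in [set k : 'I_n | (0 < k)%N]) Phi k
    & real_focal_sets [set x : 'cV[R]_n | E (g + Q *m x)]
        = [set Phi k | k in [set k : 'I_n | (0 < k)%N]] ].
Proof.
move=> g u B E D F Phi n2 _ dP QQ QB.
have n0 : (0 < n)%N by exact: ltnW.
have c0 : n%:R * n.+1%:R != 0 :> R by rewrite mulf_neq0// pnatr_eq0// -lt0n.
have [dd dp] := dP.
have QQ' := mulmx1C QQ.
have Qu : Q \in unitmx by have [] := mulmx1_unit QQ'.
(* In the coordinates y of g + W y the simplex is regular and E is the unit
   ball. *)
pose W := Q *m diag_sqrt d.
have Wu : W \in unitmx by rewrite unitmx_mul Qu diag_sqrt_unitmx.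
have BE : B = W *m W^T.
  rewrite trmx_mul mulmxA -(mulmxA Q) diag_sqrt_gram// -/D -QB.
  rewrite !mulmxA QQ' mul1mx.
  by rewrite -mulmxA QQ' mulmx1.
pose U := \matrix_(j, i) u i j 0; pose T := invmx W *m U.
have hTT : T *m T^T = (n%:R * n.+1%:R)%:M.
  rewrite trmx_mul mulmxA -(mulmxA _ U).
  have -> : U *m U^T = (n%:R * n.+1%:R) *: (W *m W^T).
    by rewrite -BE /B scalerA divff// scale1r sum_col_mul_tr.
  rewrite -scalemxAr -scalemxAl mulmxA mulVmx// mul1mx.
  rewrite trmx_inv mulmxV ?unitmx_tr//.
  by rewrite scale_scalar_mx mulr1.
have h1 : T *m (const_mx 1 : 'cV_n.+1) = 0.
  rewrite -mulmxA; have -> : U *m const_mx 1 = \sum_i u i.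
    apply/matrixP => i j; rewrite (ord1 j) summxE mxE.
    by apply: eq_bigr => k _; rewrite !mxE mulr1.
  rewrite sumrB sumr_const card_ord -scaler_nat scalerA divff ?pnatr_eq0//.
  by rewrite scale1r subrr mulmx0.
have vE i : v i = g + W *m col i T.
  have -> : col i T = invmx W *m u i.
    rewrite colE -mulmxA -colE; congr (_ *m _).
    by apply/matrixP => k j; rewrite (ord1 j) !mxE.
  by rewrite mulKVmx// addrC subrK.
have jacE x : jacobian_mx F x = D - x *m x^T - (2^-1 * sqnorm x)%:M.
  exact: jacobian_cubic_field.
split.
- by rewrite /E BE; exact: (john_ellipsoid_simplex n0 Wu (conj hTT h1) vE).
- by move=> x; split; [exact: differentiable_cubic_field|exact: jacE].
- have inj := strictly_decreasing_inj dP.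
  have shift x : has_repeated_eigenvalue (jacobian_mx F x) <->
      exists k, focal_quadric d k x.
    (* The multiple of the identity shifts all the d_j equally, and the focal
       equations involve differences only. *)
    pose c := d - const_mx (2^-1 * sqnorm x).
    have -> : jacobian_mx F x = diag_mx c - x *m x^T.
      by rewrite jacE /c linearB/= diag_const_mx addrAC.
    have cI : injective (c 0) by move=> i j; rewrite !mxE => /addIr; exact: inj.
    rewrite repeated_eigenvalue_focal//.
    suff fE k : focal_quadric c k = focal_quadric d k.
      by split=> -[k]; [rewrite fE|rewrite -fE]; exists k.
    rewrite /focal_quadric; congr mkset; apply/funext => z.
    congr (_ /\ _ = _); apply: eq_bigr => j _; congr (_ / _).
    by rewrite !mxE; ring.
  apply/seteqP; split=> x /=.
    move=> /shift[k kx]; exists k => //=.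
    by rewrite -(focal_quadric_nonempty _ dP); exists x.
  by move=> [k _ kx]; apply/shift; exists k.
- by rewrite /E BE ellipsoid_principal_coord// real_focal_setsE.
Qed.
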